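(* Let $A, B$ be real numbers such that $A^{2}+4B>0$, and let $x_{-}<x_{+}$ be the two real solutions of the equation $x^{2}=Ax+B$. Let $(a_{n})_{n\ge 0}$ be the sequence of real numbers with starting terms $a_{0}, a_{1}\in\mathbb{R}$ and satisfying $a_{n+1}=A a_{n}+B a_{n-1}$ for all integers $n\ge 1$. Then $$a_{n}=a\,x_{+}^{n}+b\,x_{-}^{n}\qquad\text{for all integers } n\ge 0,$$ where $$a=\frac{a_{1}-a_{0}x_{-}}{\sqrt{A^{2}+4B}},\qquad b=-\frac{a_{1}-a_{0}x_{+}}{\sqrt{A^{2}+4B}}.$$
   Context: Convention: $x^{0}=1$ for every real $x$, including $x=0$. *)

(* Defs.v *)
From Stdlib Require Export Reals.

(* Main.v *)
Require Import Defs.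
From Stdlib Require Import Reals Lra Lia.
Open Scope R_scope.

(** Powers of a root of x^2 = A x + B satisfy the recurrence, hence so does every combination of
    [xp ^ n] and [xm ^ n]. A solution is determined by its first two terms
    ([second_order_rec_unique]), so it suffices to match n = 0 and n = 1. By [vieta] the square root
    in [a] and [b] is [xp - xm]. *)

Lemma vieta (A B x y : R) :
  x <> y -> x ^ 2 = A * x + B -> y ^ 2 = A * y + B ->
  A = x + y /\ B = - (x * y).
Proof.
  intros hxy hx hy.
  assert (hA : A = x + y).
  (* Subtracting the two equations gives y^2 - x^2 = A (y - x). *)
  { apply (Rmult_eq_reg_r (y - x)); [nra | lra]. }
  subst A; split; [reflexivity | nra].
Qed.

Lemma second_order_rec_unique (A B : R) (s t : nat -> R) :
  s 0%nat = t 0%nat -> s 1%nat = t 1%nat ->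
  (forall n, s (S (S n)) = A * s (S n) + B * s n) ->
  (forall n, t (S (S n)) = A * t (S n) + B * t n) ->
  forall n, s n = t n.
Proof.
  intros h0 h1 hs ht n.
  (* The recurrence looks two terms back, so the induction carries two consecutive equalities. *)
  enough (h : s n = t n /\ s (S n) = t (S n)) by apply h.
  induction n as [|n [IH0 IH1]]; [now split|].
  split; [exact IH1|].
  now rewrite hs, ht, IH0, IH1.
Qed.

Theorem mainTheorem1 (A B : R) (hAB : A ^ 2 + 4 * B > 0)
  (xm xp : R) (hlt : xm < xp)
  (hroots : forall x : R, x ^ 2 = A * x + B <-> x = xm \/ x = xp)
  (s : nat -> R)
  (hrec : forall n : nat, (n >= 1)%nat ->
    s (n + 1)%nat = A * s n + B * s (n - 1)%nat) :
  let a := (s 1%nat - s 0%nat * xm) / sqrt (A ^ 2 + 4 * B) in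
  let b := - ((s 1%nat - s 0%nat * xp) / sqrt (A ^ 2 + 4 * B)) in
  forall n : nat, s n = a * xp ^ n + b * xm ^ n.
Proof.
  assert (hm : xm ^ 2 = A * xm + B) by (apply hroots; now left).
  assert (hp : xp ^ 2 = A * xp + B) by (apply hroots; now right).
  destruct (vieta A B xm xp) as [hA hB]; [lra | exact hm | exact hp |].
  assert (hsqrt : sqrt (A ^ 2 + 4 * B) = xp - xm).
  (* The discriminant is (xp + xm)^2 - 4 xp xm; [hlt] fixes the sign of its root. *)
  { replace (A ^ 2 + 4 * B) with ((xp - xm) ^ 2) by (subst A B; ring).
    apply sqrt_pow2; lra. }
  rewrite hsqrt; intros a b.
  apply (second_order_rec_unique A B).
  - unfold a, b; field; lra.
  - unfold a, b; field; lra.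
  - intro n.
    generalize (hrec (S n) ltac:(lia)).
    now replace (S n + 1)%nat with (S (S n)) by lia;
      replace (S n - 1)%nat with n by lia.
  (* With A and B written through the roots, this is a polynomial identity, valid for any
     coefficients [a], [b]. *)
  - intro n; subst A B; simpl; ring.
Qed.
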